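(* Let $1\le p<q<\infty$, let $(X,\mu)$ be a $\sigma$-finite standard measure space, let $G$ be a topological group and let $G\to\mathrm{Aut}(X,[\mu])\ltimes L_0(X,\mu,\mathbf{T})$, $g\mapsto(\sigma_g,\omega_g)$, be a continuous homomorphism. Suppose that $H^1_\sharp(G,\pi^{q,\mu},L_q(X,\mu))=0$, i.e. for every $f\in L_0(X,\mu)$ such that $\pi^{q,\mu}(g)f-f\in L_q(X,\mu)$ for all $g\in G$, there exists $h\in L_q(X,\mu)$ with $\pi^{q,\mu}(g)f-f=\pi^{q,\mu}(g)h-h$ for all $g$. Then $H^1_\sharp(G,\pi^{p,\mu},L_p(X,\mu))=0$, i.e. the same statement holds with $q$ replaced by $p$.
   Context: $\mathrm{Aut}(X,[\mu])$ is the group of nonsingular automorphisms of $(X,\mu)$ (modulo null sets), with the topology of pointwise convergence on probability measures in $[\mu]$; it acts on $L_0(X,\mu,\mathbf{T})$ by $\theta(u)=u\circ\theta^{-1}$, and the semidirect product has multiplication $(\theta,u)(\theta',u')=(\theta\theta',u\,\theta(u'))$. For $0<r<\infty$, the element $(\theta,u)$ acts on $L_0(X,\mu)$ by $\pi^{r,\mu}(\theta,u)f=u\cdot\big(\tfrac{d\theta_*\mu}{d\mu}\big)^{1/r}\,f\circ\theta^{-1}$, which restricts to a linear isometry of $L_r(X,\mu)$; composing with the homomorphism from $G$ gives $\pi^{r,\mu}:G\to$ linear maps of $L_0(X,\mu)$. $H^1(G,\pi^{r,\mu},L_r)$ is the space of continuous cocycles $c:G\to L_r$ with $c(gh)=c(g)+\pi^{r,\mu}(g)c(h)$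 modulo those of the form $g\mapsto\pi^{r,\mu}(g)f-f$ with $f\in L_r$, and $H^1_\sharp(G,\pi^{r,\mu},L_r)$ is the kernel of the natural map $H^1(G,\pi^{r,\mu},L_r(X,\mu))\to H^1(G,\pi^{r,\mu},L_0(X,\mu))$. *)

(* Defs.v *)
From HB Require Import structures.
From mathcomp Require Import all_boot all_order all_algebra.
From mathcomp Require Import all_classical all_reals all_analysis.
From mathcomp Require Import complex.
Import Order.TTheory GRing.Theory Num.Theory.

Set Implicit Arguments.
Unset Strict Implicit.
Unset Printing Implicit Defensive.

Local Open Scope classical_set_scope.
Local Open Scope ring_scope.

Definition cabs {R : rcfType} (z : R[i]) : R := Normc.normc z.

(* standard Borel space: Borel-isomorphic to a Borel subset of the reals
   (Kuratowski's characterization of standard Borel spaces) *)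
Definition standard_borel (R : realType) (d : measure_display)
    (X : measurableType d) : Prop :=
  exists (A : set R) (phi : X -> R) (psi : R -> X),
    [/\ measurable A, measurable_fun setT phi, (forall x, A (phi x)),
        measurable_fun A psi &
        (forall x, psi (phi x) = x) /\ (forall y, A y -> phi (psi y) = y)].

Definition topological_group (G : topologicalType) (mul : G -> G -> G)
    (inv : G -> G) (one : G) : Prop :=
  [/\ (forall a b c, mul a (mul b c) = mul (mul a b) c),
      (forall a, mul one a = a),
      (forall a, mul (inv a) a = one),
      continuous (fun ab : G * G => mul ab.1 ab.2) &
      continuous inv].

Section MeasureSpace.
Context {R : realType} {d : measure_display} {X : measurableType d}.
Variable mu : {measure set X -> \bar R}.

Definition cmeasurable (f : X -> R[i]) : Prop :=
  measurable_fun setT (fun x => complex.Re (f x)) /\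
  measurable_fun setT (fun x => complex.Im (f x)).

Definition L0T (u : X -> R[i]) : Prop :=
  cmeasurable u /\ {ae mu, forall x, cabs (u x) = 1}.

Definition inLr (r : R) (f : X -> R[i]) : Prop :=
  cmeasurable f /\ (\int[mu]_x ((cabs (f x)) `^ r)%:E < +oo)%E.

Definition nonsingular_aut (s si : X -> X) : Prop :=
  [/\ measurable_fun setT s, measurable_fun setT si,
      {ae mu, forall x, si (s x) = x},
      {ae mu, forall x, s (si x) = x} &
      (forall A, measurable A -> (mu (s @^-1` A) = 0%E <-> mu A = 0%E)) /\
      (forall A, measurable A -> (mu (si @^-1` A) = 0%E <-> mu A = 0%E))].

Definition RN_pushforward (s : X -> X) (J : X -> R) : Prop :=
  [/\ measurable_fun setT J, (forall x, 0 <= J x) &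
      forall A, measurable A ->
        mu (s @^-1` A) = (\int[mu]_(x in A) (J x)%:E)%E].

(* pi^{r,mu}(theta,u) f = u * (d theta_* mu / d mu)^{1/r} * f o theta^{-1},
   where si = theta^{-1} and J = d theta_* mu / d mu *)
Definition piaction (r : R) (si : X -> X) (J : X -> R) (u : X -> R[i])
    (f : X -> R[i]) : X -> R[i] :=
  fun x => u x * ((J x) `^ r^-1)%:C%C * f (si x).

Section Group.
Context {G : topologicalType}.
Variables (mul : G -> G -> G) (sigma sigi : G -> X -> X) (J : G -> X -> R)
  (omega : G -> X -> R[i]).

Definition semidirect_hom : Prop :=
  forall g h,
    {ae mu, forall x, sigma (mul g h) x = sigma g (sigma h x)} /\
    {ae mu, forall x, omega (mul g h) x = omega g x * omega h (sigi g x)}.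

(* continuity of g |-> sigma_g for the topology of pointwise (norm)
   convergence on probability measures nu in [mu]; nu = rho mu, and the
   density of (sigma_g)_* nu w.r.t. mu is (rho o sigma_g^{-1}) * J_g *)
Definition aut_continuous : Prop :=
  forall rho : X -> R, measurable_fun setT rho ->
    {ae mu, forall x, 0 < rho x} ->
    (\int[mu]_x (rho x)%:E = 1)%E ->
    forall (g0 : G) (eps : R), 0 < eps ->
      \forall g \near g0,
        (\int[mu]_x (`| rho (sigi g x) * J g x - rho (sigi g0 x) * J g0 x |)%:E
           < eps%:E)%E.

Definition L0_continuous : Prop :=
  forall A, measurable A -> (mu A < +oo)%E ->
    forall (g0 : G) (eps delta : R), 0 < eps -> 0 < delta ->
      \forall g \near g0,
        (mu (A `&` [set x | (eps < cabs (omega g x - omega g0 x))%R]) < delta%:E)%E.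

Definition pi_r (r : R) (g : G) (f : X -> R[i]) : X -> R[i] :=
  piaction r (sigi g) (J g) (omega g) f.

Definition H1sharp_zero (r : R) : Prop :=
  forall f : X -> R[i], cmeasurable f ->
    (forall g, inLr r (fun x => pi_r r g f x - f x)) ->
    exists h : X -> R[i], inLr r h /\
      forall g, {ae mu, forall x, pi_r r g f x - f x = pi_r r g h x - h x}.

End Group.
End MeasureSpace.

(* Main.v *)
Require Import Defs.
From HB Require Import structures.
From mathcomp Require Import all_boot all_order all_algebra.
From mathcomp Require Import all_classical all_reals all_analysis.
From mathcomp Require Import complex.
From mathcomp Require Import measurable_realfun.
From mathcomp Require Import ring lra.
Import Order.TTheory GRing.Theory Num.Theory.
Local Open Scope classical_set_scope.
Local Open Scope ring_scope.

(* The Mazur map [M z = |z|^(p/q - 1) z] intertwines [pi^p] with [pi^q] on [L_0]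
   and is (p/q)-Hoelder, so if [f] has [L_p] coboundary then [M f] has [L_q]
   coboundary, and the hypothesis gives [M f - k] in [L_q] with [k] invariant.
   This does not put [f - M^-1 k] in [L_p], since [M^-1] is not Hoelder.
   Applying the same to [f - M^-1 k] gives a second invariant function [k'],
   and the invariant ratio [|k|/|k'|] cuts [X] into countably many invariant
   pieces on each of which [f] (or [f - M^-1 k] where [k' = 0]) is in [L_p].
   Let [b] be an invariant function which on the n-th piece minimises the
   [L_p] distance to [f] up to [2^-n], put [w = f - b], and let [c] be
   invariant with [M w - c] in [L_q]. The pointwise inequality
   [|w - M^-1 c|^p <= |w|^p / 2 + K |M w - c|^q] and the near-minimality of [b]
   bound the integral of [|w|^p] over the pieces by a convergent series. *)

Set Implicit Arguments.
Unset Strict Implicit.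

(** * Modulus of complex numbers *)

Section Cabs.
Context {R : rcfType}.
Implicit Types z w : R[i].

Lemma cabs_ge0 z : 0 <= cabs z.
Proof. by case: z => a b; exact: sqrtr_ge0. Qed.

Lemma cabs0 : cabs (0 : R[i]) = 0.
Proof. exact: Normc.normc0. Qed.

Lemma cabs0_eq0 z : cabs z = 0 -> z = 0.
Proof. exact: Normc.eq0_normc. Qed.

Lemma cabsM z w : cabs (z * w) = cabs z * cabs w.
Proof. exact: Normc.normcM. Qed.

Lemma cabsD z w : cabs (z + w) <= cabs z + cabs w.
Proof. exact: le_normcD. Qed.

Lemma cabsN z : cabs (- z) = cabs z.
Proof. exact: normcN. Qed.

Lemma cabsBC z w : cabs (z - w) = cabs (w - z).
Proof. by rewrite -cabsN opprB. Qed.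

Lemma cabs_real (x : R) : cabs (x%:C)%C = `|x|.
Proof. by rewrite /cabs /= expr0n /= addr0 sqrtr_sqr. Qed.

Lemma cabsB_ge z w : cabs z - cabs w <= cabs (z - w).
Proof. by rewrite lerBlDr -{1}(subrK w z) cabsD. Qed.

End Cabs.

(** * Elementary inequalities for real powers *)

Section RealPowers.
Context {R : realType}.
Implicit Types (a p q r s t x y : R).

Lemma le_powR r x y : 0 <= r -> 0 <= x -> x <= y -> x `^ r <= y `^ r.
Proof.
by move=> r0 x0 xy; apply: ge0_ler_powR; rewrite // nnegrE // (le_trans x0).
Qed.

(** The sum is at most twice the larger term. This crude constant serves every exponent [r >= 0],
    below or above 1. *)
Lemma powRD_le r x y : 0 <= r -> 0 <= x -> 0 <= y ->
  (x + y) `^ r <= 2 `^ r * (x `^ r + y `^ r).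
Proof.
move=> r0; wlog xy : x y / x <= y => [H x0 y0|x0 y0].
  by have [/H|/ltW/H] := leP x y; [|rewrite addrC [x `^ r + _]addrC]; apply.
apply: (@le_trans _ _ ((2 * y) `^ r)).
  by apply: le_powR; rewrite ?addr_ge0 //; lra.
by rewrite powRM // ler_wpM2l ?powR_ge0 // lerDr powR_ge0.
Qed.

Lemma bernoulli_le1 t n : 0 <= t <= 1 -> 1 - n%:R * (1 - t) <= t ^+ n.
Proof.
move=> /andP[t0 t1]; elim: n => [|n IH]; first by rewrite mul0r subr0.
have tn1 : t ^+ n <= 1 by rewrite exprn_ile1.
rewrite exprS -natr1.
suff : 0 <= (1 - t) * (1 - t ^+ n) by lra.
by rewrite mulr_ge0 // subr_ge0.
Qed.

(** With [m] an integer at least [a], both [t] and [t ^ a] lie between [1 - m (1 - t)] and 1: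
    Bernoulli's inequality bounds [t ^ m] from below, and [t ^ m <= t ^ a]. *)
Lemma dist_powR_le a t : 0 < a -> 0 <= t <= 1 ->
  `|t - t `^ a| <= (Num.truncn a).+1%:R * (1 - t).
Proof.
move=> a0 t01; set m := (Num.truncn a).+1.
have m1 : (1 : R) <= m%:R by rewrite ler1n.
have am : a <= m%:R by have /andP[_ /ltW] := truncn_itv (ltW a0).
have lo : 1 - m%:R * (1 - t) <= t `^ a.
  apply: le_trans (bernoulli_le1 m t01) _.
  have /andP[t0 t1] := t01; move: t0; rewrite le_eqVlt => /predU1P[<-|t0].
    by rewrite expr0n powR_ge0.
  by rewrite -powR_mulrn ?(ltW t0) // ger_powR // t0.
have /andP[t0 t1] := t01.
have hi : t `^ a <= 1 by have := le_powR (ltW a0) t0 t1; rewrite powR1.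
have lo' : 1 - m%:R * (1 - t) <= t by nra.
by rewrite ler_norml; apply/andP; split; lra.
Qed.

End RealPowers.

(** * The Mazur map and its modulus of continuity *)

Section MazurMap.
Context {R : realType}.
Implicit Types (a b p q r s : R) (z w : R[i]).

(** Raises the modulus to the power [a] and keeps the phase. The factor [z] forces the value 0 at 0,
    whatever the power of 0 is. *)
Definition mazur a z : R[i] := ((cabs z `^ (a - 1))%:C)%C * z.

Lemma cabs_mazur a z : 0 < a -> cabs (mazur a z) = cabs z `^ a.
Proof.
move=> a0; rewrite /mazur cabsM cabs_real ger0_norm ?powR_ge0 //.
by rewrite mulrC mulr_powRB1 ?cabs_ge0.
Qed.

Lemma powR_cabs_mazur p q z : 0 < p -> 0 < q ->
  cabs (mazur (p / q) z) `^ q = cabs z `^ p.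
Proof.
by move=> p0 q0; rewrite cabs_mazur ?divr_gt0 // -powRrM divfK // gt_eqF.
Qed.

Lemma mazur0 a : mazur a 0 = 0.
Proof. by rewrite /mazur mulr0. Qed.

Lemma mazurM a z w : mazur a (z * w) = mazur a z * mazur a w.
Proof.
by rewrite /mazur cabsM powRM ?cabs_ge0 // rmorphM /= mulrACA.
Qed.

Lemma mazur_unit a z : cabs z = 1 -> mazur a z = z.
Proof. by rewrite /mazur => ->; rewrite powR1 mul1r. Qed.

Lemma mazur_real a (x : R) : 0 < a -> 0 <= x ->
  mazur a (x%:C)%C = ((x `^ a)%:C)%C.
Proof.
move=> a0 x0; rewrite /mazur cabs_real ger0_norm // -rmorphM /=.
by rewrite mulrC mulr_powRB1.
Qed.

Lemma mazurK a b : 0 < a -> a * b = 1 -> cancel (mazur a) (mazur b).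
Proof.
move=> a0 ab z; have [->|z0] := eqVneq z 0; first by rewrite !mazur0.
have nz : cabs z != 0 by apply: contra_neq z0; exact: cabs0_eq0.
rewrite {1}/mazur cabs_mazur // -powRrM /mazur mulrA -rmorphM /=.
rewrite -powRD; last by apply/implyP.
suff -> : a * (b - 1) + (a - 1) = 0 by rewrite powRr0 mul1r.
by rewrite mulrBr ab; ring.
Qed.

(** One estimate for all [a > 0], with the larger modulus as reference: it yields the Hoelder bound
    when [a < 1] and a local Lipschitz bound when [a > 1]. *)
Lemma mazur_dist a : 0 < a -> exists2 K : R, 0 <= K &
  forall z w, cabs w <= cabs z ->
    cabs (mazur a z - mazur a w) <= K * (cabs z `^ (a - 1) * cabs (z - w)).
Proof.
move=> a0; exists (1 + (Num.truncn a).+1%:R); first by rewrite addr_ge0.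
set m : R := _.+1%:R; move=> z w wz.
have [z0|z0] := eqVneq z 0.
  have w0 : w = 0.
    by apply: cabs0_eq0; apply/eqP; rewrite eq_le cabs_ge0 andbT -cabs0 -z0.
  by rewrite z0 w0 mazur0 !subr0 cabs0 !mulr0.
have r0 : 0 < cabs z.
  by rewrite lt_def cabs_ge0 andbT; apply: contra_neq z0; exact: cabs0_eq0.
set r := cabs z in wz r0 *; set s := cabs w in wz *.
have s0 : 0 <= s := cabs_ge0 _.
(* The first term already has the wanted form. The second has modulus [r^a |t - t^a|] with
   [t = s / r], which [dist_powR_le] bounds by a multiple of [r^(a-1) (r - s)]. *)
have -> : mazur a z - mazur a w =
    ((r `^ (a - 1))%:C)%C * (z - w) + ((r `^ (a - 1) - s `^ (a - 1))%:C)%C * w.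
  by rewrite /mazur -/r -/s rmorphB /=; ring.
apply: le_trans (cabsD _ _) _; rewrite !cabsM !cabs_real.
rewrite ger0_norm ?powR_ge0 // mulrDl mul1r lerD2l -/s.
have -> : `|r `^ (a - 1) - s `^ (a - 1)| * s = r `^ a * `|s / r - (s / r) `^ a|.
  rewrite -{2}(ger0_norm s0) -normrM -[r `^ a]ger0_norm ?powR_ge0 // -normrM.
  congr `|_|; rewrite mulrBl mulrBr -powRM ?divr_ge0 ?(ltW r0) //.
  rewrite [r * (s / r)]mulrCA divff ?gt_eqF // mulr1; congr (_ - _).
    rewrite -(mulr_powRB1 (ltW r0) a0); field; exact: lt0r_neq0.
  by rewrite mulrC mulr_powRB1.
have t01 : 0 <= s / r <= 1 by rewrite divr_ge0 ?(ltW r0) //= ler_pdivrMr // mul1r.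
apply: le_trans (ler_wpM2l (powR_ge0 _ _) (dist_powR_le a0 t01)) _.
rewrite -/m; have -> : r `^ a * (m * (1 - s / r)) = m * (r `^ (a - 1) * (r - s)).
  rewrite -(mulr_powRB1 (ltW r0) a0); field; exact: lt0r_neq0.
by rewrite !ler_wpM2l ?powR_ge0 //; exact: cabsB_ge.
Qed.

(** As [|z - w| <= 2 |z|] and [1 - a > 0], the factor [|z|^(a-1) |z - w|^(1-a)] is at most
    [2^(1-a) <= 2], leaving [|z - w|^a]. *)
Lemma mazur_holder p q : 0 < p -> p < q -> exists2 K : R, 0 <= K &
  forall z w, cabs (mazur (p / q) z - mazur (p / q) w) `^ q
    <= K * cabs (z - w) `^ p.
Proof.
move=> p0 pq; have q0 : 0 < q := lt_trans p0 pq.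
set a := p / q; have a0 : 0 < a by rewrite divr_gt0.
have a1 : a < 1 by rewrite ltr_pdivrMr // mul1r.
have [K K0 HK] := mazur_dist a0.
exists ((K * 2) `^ q); first exact: powR_ge0.
move=> z w; wlog wz : z w / cabs w <= cabs z => [H|].
  by have [/H //|/ltW/H] := leP (cabs w) (cabs z); rewrite cabsBC [cabs (w - z)]cabsBC.
have -> : cabs (z - w) `^ p = (cabs (z - w) `^ a) `^ q.
  by rewrite -powRrM /a divfK // gt_eqF.
rewrite -powRM ?mulr_ge0 ?powR_ge0 //.
apply: le_powR; rewrite ?cabs_ge0 ?(ltW q0) //.
apply: le_trans (HK _ _ wz) _; rewrite -mulrA ler_wpM2l //.
set u := cabs (z - w); set r := cabs z.
have u2r : u <= 2 * r.
  by apply: le_trans (cabsD _ _) _; rewrite cabsN -/r; move: wz; rewrite -/r; lra.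
have [->|u0] := eqVneq u 0; first by rewrite mulr0 mulr_ge0 ?powR_ge0.
have {}u0 : 0 < u by rewrite lt_def u0 cabs_ge0.
have r0 : 0 < r by lra.
rewrite -[X in _ * X <= _](_ : u `^ (1 - a) * u `^ a = u); last first.
  by rewrite -powRD ?subrK ?powRr1 ?(ltW u0) //; apply/implyP; rewrite gt_eqF.
rewrite mulrA ler_wpM2r ?powR_ge0 //.
apply: (@le_trans _ _ (r `^ (a - 1) * (2 * r) `^ (1 - a))).
  rewrite ler_wpM2l ?powR_ge0 //; apply: le_powR => //; last exact: ltW.
  by rewrite subr_ge0 ltW.
rewrite powRM ?(ltW r0) // mulrCA -powRD; last by rewrite (gt_eqF r0) implybT.
have -> : a - 1 + (1 - a) = 0 by ring.
rewrite powRr0 mulr1 ler1_powR //; lra.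
Qed.

(** For exponent [q / p > 1] the local Lipschitz constant grows with the modulus; the term [e |w|^q]
    pays for this growth, and [e] may be as small as desired. *)
Lemma mazur_lipschitz p q (e : R) : 0 < p -> p < q -> 0 < e ->
  exists2 K : R, 0 <= K &
  forall z w, cabs (mazur (q / p) z - mazur (q / p) w) `^ p
    <= e * cabs w `^ q + K * cabs (z - w) `^ q.
Proof.
move=> p0 pq e0; have q0 : 0 < q := lt_trans p0 pq.
set b := q / p; have b1 : 1 < b by rewrite ltr_pdivlMr // mul1r.
have b0 : 0 < b by lra.
have [K K0 HK] := mazur_dist b0.
set M := K `^ p * 3 `^ (q - p).
have M0 : 0 <= M by rewrite mulr_ge0 ?powR_ge0.
(* The power makes [M d^p <= e], with [M + 1] avoiding a division by 0; the bound [d <= 1] gives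
   [v + 2 s <= 3 s] when [v < d s]. *)
set d := Num.min 1 ((e / (M + 1)) `^ p^-1).
have d0 : 0 < d by rewrite lt_min ltr01 powR_gt0 // divr_gt0 //; lra.
have d1 : d <= 1 by rewrite ge_min lexx.
have Md : M * d `^ p <= e.
  have : d `^ p <= e / (M + 1).
    have -> : e / (M + 1) = ((e / (M + 1)) `^ p^-1) `^ p.
      by rewrite -powRrM mulVf ?gt_eqF // powRr1 // divr_ge0 //; lra.
    by rewrite le_powR ?(ltW p0) ?(ltW d0) // ge_min lexx orbT.
  rewrite ler_pdivlMr; last lra.
  by apply: le_trans; rewrite mulrC ler_wpM2l ?powR_ge0 //; lra.
(* Both moduli are at most [|z - w| + 2 |w|], so [mazur_dist] applies whichever of the two is
   larger. *)
have key z w : cabs (mazur b z - mazur b w) `^ p <=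
    K `^ p * (cabs (z - w) + 2 * cabs w) `^ (q - p) * cabs (z - w) `^ p.
  have bq : (b - 1) * p = q - p by rewrite mulrBl mul1r divfK ?gt_eqF.
  rewrite -bq powRrM -!powRM ?mulr_ge0 ?addr_ge0 ?mulr_ge0 ?powR_ge0 ?cabs_ge0 //.
  apply: le_powR; rewrite ?cabs_ge0 ?(ltW p0) // -mulrA.
  have zw : cabs z <= cabs (z - w) + cabs w by rewrite -{1}(subrK w z) cabsD.
  have zw0 := cabs_ge0 (z - w); have w0 := cabs_ge0 w.
  have [wz|/ltW wz] := leP (cabs w) (cabs z).
    apply: le_trans (HK _ _ wz) _; rewrite ler_wpM2l // ler_wpM2r //.
    by apply: le_powR; rewrite ?cabs_ge0 //; lra.
  rewrite cabsBC; apply: le_trans (HK _ _ wz) _.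
  rewrite cabsBC ler_wpM2l // ler_wpM2r //.
  by apply: le_powR; rewrite ?cabs_ge0 //; lra.
exists (K `^ p * (1 + 2 / d) `^ (q - p)); first by rewrite mulr_ge0 ?powR_ge0.
move=> z w; apply: le_trans (key z w) _.
set v := cabs (z - w); set s := cabs w.
have v0 : 0 <= v := cabs_ge0 _; have s0 : 0 <= s := cabs_ge0 _.
have qp0 : 0 <= q - p by lra.
have split_q x : 0 <= x -> x `^ q = x `^ (q - p) * x `^ p.
  by move=> x0; rewrite -powRD subrK // gt_eqF.
(* Close points are charged to [e s^q]. For distant ones [s <= v / d], so [v + 2 s <= (1 + 2 / d) v]
   and all is charged to [v^q]. *)
have [/ltW vs|vs] := ltP v (d * s).
  apply: (@le_trans _ _ (e * s `^ q)); last first.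
    by rewrite lerDl !mulr_ge0 ?powR_ge0.
  apply: (@le_trans _ _ (K `^ p * (3 * s) `^ (q - p) * (d * s) `^ p)).
    have v3 : v + 2 * s <= 3 * s by have : d * s <= s by [rewrite ler_piMl]; lra.
    apply: ler_pM; rewrite ?mulr_ge0 ?powR_ge0 //.
      by rewrite ler_wpM2l ?powR_ge0 // le_powR // addr_ge0 ?mulr_ge0.
    by rewrite le_powR ?(ltW p0).
  rewrite !powRM ?(ltW d0) // (split_q s s0).
  have -> : K `^ p * (3 `^ (q - p) * s `^ (q - p)) * (d `^ p * s `^ p) =
      M * d `^ p * (s `^ (q - p) * s `^ p) by rewrite /M; ring.
  by rewrite ler_wpM2r ?mulr_ge0 ?powR_ge0.
apply: (@le_trans _ _ (K `^ p * (1 + 2 / d) `^ (q - p) * v `^ q)); last first.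
  by rewrite lerDr mulr_ge0 ?powR_ge0 ?(ltW e0).
rewrite (split_q v v0) mulrA ler_wpM2r ?powR_ge0 // -mulrA ler_wpM2l ?powR_ge0 //.
rewrite -powRM ?addr_ge0 ?divr_ge0 ?(ltW d0) //.
apply: le_powR => //; first by rewrite addr_ge0 ?mulr_ge0.
rewrite [leRHS]mulrDl mul1r lerD2l mulrAC -mulrA ler_wpM2l // ler_pdivlMr // mulrC.
by [].
Qed.

End MazurMap.

(** * Pointwise inequalities behind the descent *)

Section PointwiseBounds.
Context {R : realType}.
Implicit Types (p q : R) (z w : R[i]).

(** This is [mazur_lipschitz] at [c] and [M w], with [M] the Mazur map of exponent [p / q]. The
    coefficient 1/2 is below 1 so that the term can later be absorbed. *)
Lemma mazur_recover p q : 0 < p -> p < q -> exists2 K : R, 0 <= K &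
  forall w c, cabs (w - mazur (q / p) c) `^ p
    <= 2^-1 * cabs w `^ p + K * cabs (mazur (p / q) w - c) `^ q.
Proof.
move=> p0 pq; have q0 := lt_trans p0 pq.
have h0 : (0 : R) < 2^-1 by lra.
have [K K0 HK] := mazur_lipschitz p0 pq h0.
exists K => // w c; have := HK c (mazur (p / q) w).
rewrite mazurK ?divr_gt0 //; last first.
  by rewrite mulrA divfK ?divff ?gt_eqF.
by rewrite powR_cabs_mazur // cabsBC [cabs (c - _)]cabsBC.
Qed.

(* Writing [F = f - M^-1 k], if [M f] is close to [k] relative to [|k|] then
   [M F] is close to [0], so [|k| <= m |k'|] keeps it away from [k']. *)
Lemma mazur_two_centers p q (m : R) : 0 < p -> p < q -> 0 <= m ->
  exists2 K : R, 0 <= K & forall f k k' : R[i], cabs k <= m * cabs k' ->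
    cabs f `^ p <= K * cabs (mazur (p / q) f - k) `^ q
      + K * cabs (mazur (p / q) (f - mazur (q / p) k) - k') `^ q.
Proof.
move=> p0 pq m0; have q0 := lt_trans p0 pq.
set A := m `^ q * 2 `^ q.
have A0 : 0 <= A by rewrite mulr_ge0 ?powR_ge0.
(* Below, [|k|^q <= A (|F|^p + |h'|^q)], and [|F|^p] is in turn bounded by [e |k|^q] plus a multiple
   of [|h|^q]. Since [A e <= 1/2], the returning [|k|^q] is absorbed. *)
set e := (2 * (A + 1))^-1.
have e0 : 0 < e by rewrite invr_gt0; lra.
have Ae : A * e <= 2^-1.
  rewrite /e invfM mulrCA ler_piMr ?invr_ge0 // ler_pdivrMr; lra.
have [K K0 HK] := mazur_lipschitz p0 pq e0.
set B : R := 2 `^ q; have B0 : 0 <= B := powR_ge0 _ _.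
have A2 : 0 <= 2 * A by rewrite mulr_ge0.
have D0 : 0 <= B * (2 * A * K + 1) by rewrite (mulr_ge0 B0) // addr_ge0 // (mulr_ge0 A2).
exists (B * (2 * A * K + 1) + B * (2 * A)); first by rewrite addr_ge0 // (mulr_ge0 B0).
move=> f k k' kk'.
have fp := powR_cabs_mazur f p0 q0.
have Fp := powR_cabs_mazur (f - mazur (q / p) k) p0 q0.
have := HK (mazur (p / q) f) k.
rewrite mazurK ?divr_gt0 //; last by rewrite mulrA divfK ?divff ?gt_eqF.
set h := mazur (p / q) f - k; set F := f - _; set h' := mazur (p / q) F - k'.
set Fq := cabs F `^ p; set kq := cabs k `^ q; set H := cabs h `^ q.
set H' := cabs h' `^ q; move=> bF.
have H0 : 0 <= H := powR_ge0 _ _; have H'0 : 0 <= H' := powR_ge0 _ _.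
have bk' : cabs k' `^ q <= B * (Fq + H').
  rewrite /Fq -Fp.
  apply: (@le_trans _ _ ((cabs (mazur (p / q) F) + cabs h') `^ q)); last first.
    by apply: powRD_le; rewrite ?cabs_ge0 ?(ltW q0).
  apply: le_powR; rewrite ?cabs_ge0 ?(ltW q0) //.
  have -> : k' = mazur (p / q) F + - h' by rewrite /h'; ring.
  by rewrite -[cabs h']cabsN cabsD.
have bk : kq <= A * (Fq + H').
  rewrite /A -mulrA; apply: (@le_trans _ _ (m `^ q * cabs k' `^ q)).
    by rewrite -powRM ?cabs_ge0 //; apply: le_powR; rewrite ?cabs_ge0 ?(ltW q0).
  by rewrite ler_wpM2l ?powR_ge0.
have kq0 : 0 <= kq := powR_ge0 _ _.
have bk2 : kq <= 2 * A * K * H + 2 * A * H'.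
  have : A * (Fq + H') <= A * (e * kq + K * H + H') by rewrite ler_wpM2l //; lra.
  have : A * e * kq <= 2^-1 * kq by rewrite ler_wpM2r.
  lra.
have bf : cabs f `^ p <= B * (kq + H).
  rewrite -fp; apply: (@le_trans _ _ ((cabs k + cabs h) `^ q)); last first.
    by apply: powRD_le; rewrite ?cabs_ge0 ?(ltW q0).
  apply: le_powR; rewrite ?cabs_ge0 ?(ltW q0) //.
  have -> : mazur (p / q) f = k + h by rewrite /h; ring.
  exact: cabsD.
apply: le_trans bf _.
have : B * (kq + H) <= B * (2 * A * K * H + 2 * A * H' + H) by rewrite ler_wpM2l //; lra.
have : 0 <= B * (2 * A) * H by rewrite mulr_ge0 // mulr_ge0.
have : 0 <= B * (2 * A * K + 1) * H' by rewrite mulr_ge0.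
lra.
Qed.

End PointwiseBounds.

(** * Measurability of complex functions and of countable gluings *)

Section Measurability.
Context {R : realType} {d : measure_display} {X : measurableType d}.
Implicit Types (f g : X -> R[i]).

Lemma cmeasurable0 : cmeasurable (fun _ : X => 0 : R[i]).
Proof. by split; exact: measurable_cst. Qed.

Lemma cmeasurableB f g : cmeasurable f -> cmeasurable g ->
  cmeasurable (fun x => f x - g x).
Proof.
move=> [f1 f2] [g1 g2]; split.
  rewrite (_ : (fun x => _) = (fun x => complex.Re (f x) - complex.Re (g x))).
    exact: measurable_funB.
  by apply/funext => x; rewrite raddfB.
rewrite (_ : (fun x => _) = (fun x => complex.Im (f x) - complex.Im (g x))).
  exact: measurable_funB.
by apply/funext => x; rewrite raddfB.
Qed.

Lemma cmeasurableM f g : cmeasurable f -> cmeasurable g ->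
  cmeasurable (fun x => f x * g x).
Proof.
move=> [f1 f2] [g1 g2]; split.
  rewrite (_ : (fun x => _) = (fun x => complex.Re (f x) * complex.Re (g x) -
    complex.Im (f x) * complex.Im (g x))).
    by apply: measurable_funB; exact: measurable_funM.
  by apply/funext => x; case: (f x) (g x) => [a b] [a' b'].
rewrite (_ : (fun x => _) = (fun x => complex.Re (f x) * complex.Im (g x) +
    complex.Im (f x) * complex.Re (g x))).
  by apply: measurable_funD; exact: measurable_funM.
by apply/funext => x; case: (f x) (g x) => [a b] [a' b'].
Qed.

Lemma cmeasurable_real (r : X -> R) : measurable_fun setT r ->
  cmeasurable (fun x => (r x)%:C%C).
Proof. by move=> mr; split => //; exact: measurable_cst. Qed.

Lemma cmeasurable_comp f (s : X -> X) : cmeasurable f -> measurable_fun setT s ->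
  cmeasurable (fun x => f (s x)).
Proof.
move=> [f1 f2] ms; split.
  exact: measurableT_comp f1 ms.
exact: measurableT_comp f2 ms.
Qed.

Lemma measurable_cabs f : cmeasurable f -> measurable_fun setT (fun x => cabs (f x)).
Proof.
move=> [f1 f2].
rewrite (_ : (fun x => _) = (fun x =>
   (complex.Re (f x) ^+ 2 + complex.Im (f x) ^+ 2) `^ 2^-1)).
  apply: (measurableT_comp (measurable_powR _)).
  by apply: measurable_funD; exact: measurable_funX.
apply/funext => x; rewrite powR12_sqrt ?addr_ge0 ?sqr_ge0 //.
by case: (f x).
Qed.

Lemma measurable_powR_cabs f r : cmeasurable f ->
  measurable_fun setT (fun x => cabs (f x) `^ r).
Proof.
move=> mf.
by apply: (measurableT_comp (measurable_powR _)) (measurable_cabs mf).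
Qed.

Lemma cmeasurable_mazur f a : cmeasurable f -> cmeasurable (fun x => mazur a (f x)).
Proof.
move=> mf; apply: cmeasurableM => //.
exact: cmeasurable_real (measurable_powR_cabs _ mf).
Qed.

Lemma measurable_fun_glue d' (Y : measurableType d') (N : X -> nat) (b : nat -> X -> Y) :
  (forall n, measurable [set x | N x = n]) ->
  (forall n, measurable_fun setT (b n)) ->
  measurable_fun setT (fun x => b (N x) x).
Proof.
move=> mN mb.
have -> : [set: X] = \bigcup_n [set x | N x = n].
  by apply/seteqP; split => // x _; exists (N x).
apply/measurable_fun_bigcup => // n.
apply: (@eq_measurable_fun _ _ _ _ _ (b n)).
  by move=> x; rewrite inE /= => ->.
exact: measurable_funS (mb n).
Qed.

Lemma cmeasurable_glue (N : X -> nat) (b : nat -> X -> R[i]) :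
  (forall n, measurable [set x | N x = n]) ->
  (forall n, cmeasurable (b n)) -> cmeasurable (fun x => b (N x) x).
Proof.
move=> mN mb; split.
  apply: (measurable_fun_glue mN (b := fun n x => complex.Re (b n x))) => n.
  by case: (mb n).
apply: (measurable_fun_glue mN (b := fun n x => complex.Im (b n x))) => n.
by case: (mb n).
Qed.

End Measurability.

(** * Integrals of powers of the modulus *)

Section PowerIntegral.
Context {R : realType} {d : measure_display} {X : measurableType d}.
Variable mu : {measure set X -> \bar R}.
Implicit Types (f g : X -> R[i]) (E : set X) (r : R).

(** The [r]-th power of the [L_r] norm on [E]: without the root it is additive over disjoint
    pieces. *)
Definition pow_integral E r f : \bar R := (\int[mu]_(x in E) (cabs (f x) `^ r)%:E)%E.

Lemma pow_integral_ge0 E r f : (0 <= pow_integral E r f)%E.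
Proof. by apply: integral_ge0 => x _; rewrite lee_fin powR_ge0. Qed.

Let measurable_pow E f r : cmeasurable f ->
  measurable_fun E (fun x => (cabs (f x) `^ r)%:E).
Proof.
move=> mf; apply: (@measurable_funS _ _ _ _ setT) => //.
exact/measurable_EFinP/measurable_powR_cabs.
Qed.

(** The exponents are independent, so that [L_p] and [L_q] quantities can be compared. Uses with a
    single term take [C2 = 0] and repeat [g1]. *)
Lemma pow_integral_bound E r r1 r2 f g1 g2 (C1 C2 : R) :
  measurable E -> cmeasurable f -> cmeasurable g1 -> cmeasurable g2 ->
  0 <= C1 -> 0 <= C2 ->
  {ae mu, forall x, E x ->
    cabs (f x) `^ r <= C1 * cabs (g1 x) `^ r1 + C2 * cabs (g2 x) `^ r2} ->
  (pow_integral E r f <=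
    C1%:E * pow_integral E r1 g1 + C2%:E * pow_integral E r2 g2)%E.
Proof.
move=> mE mf mg1 mg2 C10 C20 H.
have p0 (C : R) g s x : 0 <= C -> (0 <= C%:E * (cabs (g x) `^ s)%:E)%E.
  by move=> C0; rewrite mule_ge0 // lee_fin ?powR_ge0.
have mp (C : R) g s : cmeasurable g ->
    measurable_fun E (fun x => C%:E * (cabs (g x) `^ s)%:E)%E.
  by move=> mg; apply: measurable_funeM; exact: measurable_pow.
have pw g s (x : X) : E x -> (0 <= (cabs (g x) `^ s)%:E)%E by rewrite lee_fin powR_ge0.
rewrite -(ge0_integralZl_EFin _ mE (pw g1 r1)) //; last exact: measurable_pow.
rewrite -(ge0_integralZl_EFin _ mE (pw g2 r2)) //; last exact: measurable_pow.
rewrite -(ge0_integralD _ mE (fun x _ => p0 C1 g1 r1 x C10) (mp C1 g1 r1 mg1)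
  (fun x _ => p0 C2 g2 r2 x C20) (mp C2 g2 r2 mg2)).
apply: ae_ge0_le_integral => //.
- by move=> x _; rewrite lee_fin powR_ge0.
- exact: measurable_pow.
- by move=> x _; rewrite adde_ge0 // p0.
- by apply: emeasurable_funD; exact: mp.
Qed.

Lemma pow_integral_subset E r f : measurable E -> cmeasurable f ->
  (pow_integral E r f <= pow_integral setT r f)%E.
Proof.
move=> mE mf; apply: ge0_subset_integral => //.
- exact: measurable_pow.
- by move=> x _; rewrite lee_fin powR_ge0.
Qed.

Lemma pow_integral_bigcup (N : X -> nat) r f :
  (forall n, measurable [set x | N x = n]) -> cmeasurable f ->
  pow_integral setT r f =
  (\sum_(n <oo) pow_integral [set x | N x = n] r f)%E.
Proof.
move=> mN mf; rewrite /pow_integral.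
have -> : [set: X] = \bigcup_n [set x | N x = n].
  by apply/seteqP; split => // x _; exists (N x).
apply: ge0_integral_bigcup => //.
- exact: measurable_pow.
- by move=> x _; rewrite lee_fin powR_ge0.
- by move=> i j _ _ [x [/= <- <-]].
Qed.

End PowerIntegral.

(** * Invariant functions, coboundaries and the Mazur map *)

Section Representation.
Context {R : realType} {d : measure_display} {X : measurableType d}.
Variable mu : {measure set X -> \bar R}.
Context {G : topologicalType}.
Variables (sigma sigi : G -> X -> X) (J : G -> X -> R) (omega : G -> X -> R[i]).
Hypothesis sigmaP : forall g, nonsingular_aut mu (sigma g) (sigi g).
Hypothesis JP : forall g, RN_pushforward mu (sigma g) (J g).
Hypothesis omegaP : forall g, L0T mu (omega g).
Implicit Types (p q r s : R) (f b : X -> R[i]) (g : G).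

Local Notation pi := (pi_r sigi J omega).

(** The exceptional null set may depend on [g], as [G] may be uncountable. *)
Definition pi_invariant r b : Prop :=
  cmeasurable b /\ forall g, {ae mu, forall x, pi r g b x = b x}.

(** Such an [f] represents a class of the kernel of the map from [L_r] to [L_0] cohomology. *)
Definition Lr_coboundary r f : Prop :=
  cmeasurable f /\ forall g, inLr mu r (fun x => pi r g f x - f x).

Lemma cmeasurable_pi r g f : cmeasurable f -> cmeasurable (pi r g f).
Proof.
move=> mf; have [_ msi _ _ _] := sigmaP g; have [mJ _ _] := JP g.
have [mo _] := omegaP g.
apply: cmeasurableM; last exact: cmeasurable_comp.
apply: cmeasurableM => //; apply: cmeasurable_real.
exact: (measurableT_comp (measurable_powR _)).
Qed.

Lemma piB r g f b x : pi r g (fun y => f y - b y) x = pi r g f x - pi r g b x.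
Proof. by rewrite /pi_r /piaction mulrBr. Qed.

(** The zero set of [J g] has a preimage of measure 0, the integral of [J g] over it, so
    nonsingularity makes it null. *)
Lemma ae_J_gt0 g : {ae mu, forall x, 0 < J g x}.
Proof.
have [_ _ _ _ [ns _]] := sigmaP g; have [mJ J0 RN] := JP g.
have mA : measurable [set x | J g x = 0].
  rewrite -[X in measurable X]setTI; apply: (mJ _ [set 0]) => //.
exists [set x | J g x = 0]; split => //.
  apply/(ns _ mA); rewrite RN //; apply: integral0_eq => x /= ->.
  by [].
move=> x /= /negP; rewrite -leNgt => Jx.
by apply/eqP; rewrite eq_le Jx J0.
Qed.

Lemma ae_cabs_omega g : {ae mu, forall x, cabs (omega g x) = 1}.
Proof. by case: (omegaP g). Qed.

Lemma cabs_pi r g f x : cabs (omega g x) = 1 ->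
  cabs (pi r g f x) = J g x `^ r^-1 * cabs (f (sigi g x)).
Proof.
move=> o1; rewrite /pi_r /piaction !cabsM o1 mul1r cabs_real.
by rewrite ger0_norm // powR_ge0.
Qed.

(** The Mazur map is multiplicative, fixes the unimodular [omega g x], and turns [J^(1/r)] into
    [J^(1/s)]. *)
Lemma mazur_pi r s g f x : 0 < r -> 0 < s -> cabs (omega g x) = 1 ->
  mazur (r / s) (pi r g f x) = pi s g (fun y => mazur (r / s) (f y)) x.
Proof.
move=> r0 s0 o1; have [_ J0 _] := JP g.
rewrite /pi_r /piaction !mazurM mazur_unit // mazur_real ?divr_gt0 ?powR_ge0 //.
by rewrite -powRrM mulrA mulVf ?gt_eqF // mul1r.
Qed.

Lemma invariant0 r : pi_invariant r (fun _ => 0).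
Proof.
split; first exact: cmeasurable0.
by move=> g; apply: aeW => x; rewrite /pi_r /piaction mulr0.
Qed.

Lemma invariantB r f b : pi_invariant r f -> pi_invariant r b ->
  pi_invariant r (fun x => f x - b x).
Proof.
move=> [mf If] [mb Ib]; split; first exact: cmeasurableB.
move=> g; move: (If g) (Ib g); apply: filterS2 => x fx bx.
by rewrite piB fx bx.
Qed.

Lemma invariant_mazur r s b : 0 < r -> 0 < s -> pi_invariant r b ->
  pi_invariant s (fun x => mazur (r / s) (b x)).
Proof.
move=> r0 s0 [mb Ib]; split; first exact: cmeasurable_mazur.
move=> g; move: (Ib g) (ae_cabs_omega g); apply: filterS2 => x bx o1.
by rewrite -mazur_pi // bx.
Qed.

(** Invariance of [N] makes [x] and [sigi g x] use the same index, and the null sets of the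
    countably many [b n] are united. *)
Lemma invariant_glue r (N : X -> nat) (b : nat -> X -> R[i]) :
  (forall n, measurable [set x | N x = n]) ->
  (forall g, {ae mu, forall x, N (sigi g x) = N x}) ->
  (forall n, pi_invariant r (b n)) -> pi_invariant r (fun x => b (N x) x).
Proof.
move=> mN IN Ib; split; first by apply: cmeasurable_glue => // n; case: (Ib n).
move=> g; have /ae_foralln : forall n, {ae mu, forall x, pi r g (b n) x = b n x}.
  by move=> n; case: (Ib n).
move: (IN g); apply: filterS2 => x Nx bx.
by rewrite -[RHS]bx /pi_r /piaction Nx.
Qed.

Lemma Lr_coboundaryB r f b : 0 < r -> Lr_coboundary r f -> pi_invariant r b ->
  Lr_coboundary r (fun x => f x - b x).
Proof.
move=> r0 [mf Hf] [mb Ib]; have mfb := cmeasurableB mf mb.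
split; first exact: mfb.
move=> g; have [mpf ipf] := Hf g.
split; first by apply: cmeasurableB => //; exact: cmeasurable_pi.
apply: le_lt_trans ipf.
have mpi : cmeasurable (fun x => pi r g (fun y => f y - b y) x - (f x - b x)).
  by apply: cmeasurableB => //; exact: cmeasurable_pi.
have := @pow_integral_bound _ _ _ mu setT r r r _ _ _ 1 0
  measurableT mpi mpf mpf ler01 (lexx 0).
rewrite mul1e mul0e adde0; apply.
move: (Ib g); apply: filterS => x bx _.
rewrite piB bx mul1r mul0r addr0.
by have -> : pi r g f x - b x - (f x - b x) = pi r g f x - f x by ring.
Qed.

Lemma Lr_coboundary_mazur p q f : 0 < p -> p < q -> Lr_coboundary p f ->
  Lr_coboundary q (fun x => mazur (p / q) (f x)).
Proof.
move=> p0 pq [mf Hf]; have q0 := lt_trans p0 pq.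
have mM := cmeasurable_mazur (p / q) mf.
split; first exact: mM.
move=> g; have [mpf ipf] := Hf g.
have mpi : cmeasurable (fun x =>
    pi q g (fun y => mazur (p / q) (f y)) x - mazur (p / q) (f x)).
  by apply: cmeasurableB => //; exact: cmeasurable_pi.
split; first exact: mpi.
have [K K0 HK] := mazur_holder p0 pq.
apply: (@le_lt_trans _ _ (K%:E * pow_integral mu setT p (fun x => pi p g f x - f x)%R)%E).
  have := @pow_integral_bound _ _ _ mu setT q p p _ _ _ K 0
    measurableT mpi mpf mpf K0 (lexx 0).
  rewrite mul0e adde0; apply.
  move: (ae_cabs_omega g); apply: filterS => x o1 _.
  by rewrite -mazur_pi // mul0r addr0.
by apply: lte_mul_pinfty.
Qed.

(** * Descent from exponent [q] to exponent [p] *)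

Section Descent.
Variables p q : R.
Hypotheses (p0 : 0 < p) (pq : p < q).
Hypothesis Hq : H1sharp_zero mu sigi J omega q.

Let q0 : 0 < q := lt_trans p0 pq.

(** The hypothesis gives [h] in [L_q] with the same coboundary as [M f]; hence [k = M f - h] is
    invariant. *)
Lemma exists_invariant f : Lr_coboundary p f ->
  exists2 k, pi_invariant q k & inLr mu q (fun x => mazur (p / q) (f x) - k x).
Proof.
move=> /(Lr_coboundary_mazur p0 pq)[mM cM].
have [h [[mh ih] Hh]] := Hq mM cM.
exists (fun x => mazur (p / q) (f x) - h x).
  split; first exact: cmeasurableB.
  move=> g; move: (Hh g); apply: filterS => x; rewrite piB => e.
  apply/eqP; rewrite -subr_eq0; apply/eqP.
  rewrite -[RHS](subrr (pi q g h x - h x)) -{1}e; ring.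
have -> : (fun x => mazur (p / q) (f x) - (mazur (p / q) (f x) - h x)) = h.
  by apply/funext => x; ring.
by [].
Qed.

(** The finite distances on the pieces need not be summable. Choosing nearly optimal invariant
    functions and then using the hypothesis once, globally, makes them so. *)
Lemma Lr_dist_from_pieces f (N : X -> nat) : Lr_coboundary p f ->
  (forall n, measurable [set x | N x = n]) ->
  (forall g, {ae mu, forall x, N (sigi g x) = N x}) ->
  (forall n, exists2 b, pi_invariant p b &
    (pow_integral mu [set x | N x = n] p (fun x => f x - b x)%R < +oo)%E) ->
  exists2 b, pi_invariant p b & inLr mu p (fun x => f x - b x).
Proof.
move=> Df mN IN HN; have [mf _] := Df.
pose E n := [set x | N x = n].
pose S n := [set pow_integral mu (E n) p (fun x => f x - b x)%R | b in pi_invariant p].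
have S0 n : (0 <= ereal_inf (S n))%E.
  by apply: le_ereal_inf_tmp => _ [b _ <-]; exact: pow_integral_ge0.
pose e (n : nat) : R := (2 ^ n.+1)%:R^-1.
have e0 n : 0 < e n by rewrite invr_gt0 ltr0n expn_gt0.
have Sb n : exists b, [/\ pi_invariant p b,
    (pow_integral mu (E n) p (fun x => f x - b x)%R < +oo)%E &
    forall b', pi_invariant p b' ->
      (pow_integral mu (E n) p (fun x => f x - b x)%R <=
       pow_integral mu (E n) p (fun x => f x - b' x)%R + (e n)%:E)%E].
  have Sfin : ereal_inf (S n) \is a fin_num.
    rewrite ge0_fin_numE //; have [b Ib b_fin] := HN n.
    by apply: le_lt_trans b_fin; apply: ereal_inf_lbound; exists b.
  have [_ [b Ib <-] lt_b] := lb_ereal_inf_adherent (e0 n) Sfin.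
  exists b; split => //.
    by apply: lt_trans lt_b _; rewrite lte_add_pinfty ?ltry // ltey_eq Sfin.
  move=> b' Ib'; apply: le_trans (ltW lt_b) _; rewrite leeD2r //.
  by apply: ereal_inf_lbound; exists b'.
have [b_ Hb] := choice Sb.
pose b x := b_ (N x) x; pose w x := f x - b x.
have Ib : pi_invariant p b by apply: invariant_glue => // n; have [] := Hb n.
have Dw : Lr_coboundary p w by exact: Lr_coboundaryB.
have mw : cmeasurable w by case: Dw.
have [c Ic [mh ih]] := exists_invariant Dw.
set h := fun x => _ in mh ih.
have [K K0 HK] := mazur_recover p0 pq.
have wE n : pow_integral mu (E n) p w = pow_integral mu (E n) p (fun x => f x - b_ n x)%R.
  by apply: eq_integral => x; rewrite inE /E /= /w /b => ->.
(* The competitor [b + M^-1 c], written as a double difference so that [invariantB] applies. *)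
have Ib' : pi_invariant p (fun x => b x - (0 - mazur (q / p) (c x))).
  apply: invariantB => //; apply: invariantB; first exact: invariant0.
  exact: invariant_mazur.
(* Near-minimality against the competitor and [mazur_recover] bound the integral of [|w|^p] by half
   of itself plus [K] times that of [|h|^q] plus [e n]. It is finite, so the half can be moved to
   the left. *)
have bound n : (pow_integral mu (E n) p w <=
    (2 * K)%:E * pow_integral mu (E n) q h + (2 / (2 ^ n.+1)%:R)%:E)%E.
  have [_ w_fin /(_ _ Ib')] := Hb n; rewrite -wE => le_w.
  have le_w' : (pow_integral mu (E n) p
        (fun x => f x - (b x - (0 - mazur (q / p) (c x))))%R <=
      2^-1%:E * pow_integral mu (E n) p w + K%:E * pow_integral mu (E n) q h)%E.
    apply: pow_integral_bound => //; first exact: (mN n).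
    - by apply: cmeasurableB => //; case: Ib'.
    - apply: aeW => x _; have := HK (w x) (c x).
      by have -> : w x - mazur (q / p) (c x) = f x - (b x - (0 - mazur (q / p) (c x)))
        by rewrite /w; ring.
  have H_fin : (pow_integral mu (E n) q h < +oo)%E.
    by apply: le_lt_trans (pow_integral_subset _ _ _ _) ih; first exact: (mN n).
  move: le_w le_w' w_fin H_fin; rewrite -wE.
  have := pow_integral_ge0 mu (E n) p w; have := pow_integral_ge0 mu (E n) q h.
  move: (pow_integral mu _ p _) (pow_integral mu _ q h) (pow_integral mu _ p w).
  move=> [a| |] [a'| |] [a''| |] //=; try by rewrite addye.
  rewrite -?EFinM -?EFinD !lee_fin /e => *; lra.
exists b; first exact: Ib.
split; first exact: mw.
rewrite -/(pow_integral mu setT p w) (pow_integral_bigcup mu p mN mw).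
apply: (@le_lt_trans _ _ (\sum_(n <oo) ((2 * K)%:E * pow_integral mu (E n) q h
    + (2 / (2 ^ n.+1)%:R)%:E))%E).
  by apply: lee_nneseries => n *; [exact: pow_integral_ge0|exact: bound].
(* The errors [2 / 2^(n+1)] add up to 2, and the integrals of [|h|^q] over the pieces to the finite
   one over [X]. *)
apply: (le_lt_trans (@epsilon_trick R
  (fun n => (2 * K)%:E * pow_integral mu (E n) q h)%E 2 xpredT _ _)) => //.
  by move=> n; rewrite mule_ge0 ?pow_integral_ge0 // lee_fin mulr_ge0.
rewrite nneseriesZl => [|n _]; last exact: pow_integral_ge0.
rewrite -(pow_integral_bigcup mu q mN mh) lte_add_pinfty ?ltry //.
by apply: lte_mul_pinfty; rewrite ?lee_fin ?mulr_ge0.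
Qed.

Lemma H1sharp_zero_descent : H1sharp_zero mu sigi J omega p.
Proof.
move=> f mf Hf; have Df : Lr_coboundary p f by [].
have [k Ik [mh ih]] := exists_invariant Df.
set h := fun x => _ in mh ih.
have Imk : pi_invariant p (fun x => mazur (q / p) (k x)) by exact: invariant_mazur.
have [k' Ik' [mh' ih']] := exists_invariant (Lr_coboundaryB p0 Df Imk).
set h' := fun x => _ in mh' ih'.
have [mk _] := Ik; have [mk' _] := Ik'.
pose t x := cabs (k x) / cabs (k' x).
have t0 x : 0 <= t x by rewrite divr_ge0 ?cabs_ge0.
(* Index 0 is reserved for [k' = 0]. The shift by one makes piece [n+1] the set where
   [n <= t < n+1], so that [|k| <= (n+1) |k'|] there. *)
pose N x := if cabs (k' x) == 0 then 0%N else (Num.truncn (t x)).+1.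
have mt : measurable_fun setT t.
  have -> : t = (fun x => cabs (k x) * cabs (k' x) `^ (-1)).
    by apply/funext => x; rewrite powR_inv1 ?cabs_ge0.
  by apply: measurable_funM; [exact: measurable_cabs|exact: measurable_powR_cabs].
have mk'0 : measurable [set x | cabs (k' x) = 0].
  rewrite -[X in measurable X]setTI.
  exact: (measurable_cabs mk' measurableT (measurable_set1 0)).
have mN n : measurable [set x | N x = n].
  case: n => [|n].
    have -> : [set x | N x = 0%N] = [set x | cabs (k' x) = 0] => //.
    by apply/seteqP; split => x /=; rewrite /N; case: eqP.
  have -> : [set x | N x = n.+1] =
      (setT `&` t @^-1` `[n%:R, n.+1%:R[) `\` [set x | cabs (k' x) = 0].
    apply/seteqP; split => x /=; rewrite /N; case: eqP => //=.
    - by move=> k'0 [tn]; rewrite in_itv /= -tn truncn_itv.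
    - by move=> k'0 [].
    - by move=> k'0 [[_]]; rewrite in_itv /= => /truncn_def ->.
  by apply: measurableD => //; exact: mt.
(* The action scales both moduli by the same positive factor [J^(1/q)], which cancels in the ratio
   and preserves the vanishing of [k']. *)
have IN g : {ae mu, forall x, N (sigi g x) = N x}.
  have aeg : \forall x \ae mu, cabs (omega g x) = 1 /\ 0 < J g x.
    by move: (ae_cabs_omega g) (ae_J_gt0 g); apply: filterS2.
  move: aeg (Ik.2 g) (Ik'.2 g); apply: filterS3 => x [] o1 J0 kx k'x.
  have s0 := powR_gt0 q^-1 J0.
  have k1 := cabs_pi q k o1; have k1' := cabs_pi q k' o1.
  rewrite /N /t -kx -k'x k1 k1' mulf_eq0 (gt_eqF s0) /=.
  case: eqP => // k'0; congr (Num.truncn _).+1.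
  by rewrite invfM mulrACA divff ?gt_eqF // mul1r.
have hfin n (u : X -> R[i]) : cmeasurable u ->
    (pow_integral mu setT q u < +oo)%E ->
    (pow_integral mu [set x | N x = n] q u < +oo)%E.
  by move=> mu_u; apply: le_lt_trans; apply: pow_integral_subset.
have [|b Ib [mw iw]] := Lr_dist_from_pieces Df mN IN.
  case=> [|n].
    (* Where [k' = 0], [h'] is the Mazur image of [f - M^-1 k], so [|h'|^q = |f - M^-1 k|^p]. *)
    exists (fun x => mazur (q / p) (k x)); first exact: Imk.
    have mF := cmeasurableB mf Imk.1.
    apply: le_lt_trans (hfin 0%N _ mh' ih').
    have := @pow_integral_bound _ _ _ mu [set x | N x = 0%N] p q q _ _ _ 1 0
      (mN 0%N) mF mh' mh' ler01 (lexx 0).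
    rewrite mul1e mul0e adde0; apply; apply: aeW => x /=.
    rewrite /N; case: eqP => // /cabs0_eq0 k'0 _.
    by rewrite /h' k'0 subr0 powR_cabs_mazur // mul1r mul0r addr0.
  (* On the other pieces [f] itself is in [L_p], by [mazur_two_centers] with [m = n+1]. *)
  exists (fun=> 0); first exact: invariant0.
  have [K K0 HK] := @mazur_two_centers R p q n.+1%:R p0 pq (ler0n _ _).
  have mf0 := cmeasurableB mf (@cmeasurable0 R d X).
  apply: (@le_lt_trans _ _ (K%:E * pow_integral mu [set x | N x = n.+1] q h +
      K%:E * pow_integral mu [set x | N x = n.+1] q h')%E); last first.
    have Kfin y : (y < +oo)%E -> (K%:E * y < +oo)%E by exact: lte_mul_pinfty.
    apply: lte_add_pinfty; first exact: Kfin (hfin n.+1 _ mh ih).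
    exact: Kfin (hfin n.+1 _ mh' ih').
  apply: pow_integral_bound => //; apply: aeW => x /=.
  rewrite /N subr0; case: eqP => // /eqP k'0 [tn]; apply: HK.
  have /andP[_ /ltW] := truncn_itv (t0 x); rewrite tn /t ler_pdivrMr //.
  by rewrite lt_def k'0 cabs_ge0.
exists (fun x => f x - b x); split => // g.
move: (Ib.2 g); apply: filterS => x bx.
by rewrite piB bx; ring.
Qed.

End Descent.
End Representation.

Unset Implicit Arguments.

Theorem theorem5p4 (R : realType) (p q : R)
  (d : measure_display) (X : measurableType d) (mu : {measure set X -> \bar R})
  (G : topologicalType) (gmul : G -> G -> G) (ginv : G -> G) (g1 : G)
  (sigma sigi : G -> X -> X) (J : G -> X -> R) (omega : G -> X -> R[i]) :
  1 <= p -> p < q ->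
  sigma_finite setT mu -> standard_borel R X ->
  topological_group gmul ginv g1 ->
  (forall g, nonsingular_aut mu (sigma g) (sigi g)) ->
  (forall g, RN_pushforward mu (sigma g) (J g)) ->
  (forall g, L0T mu (omega g)) ->
  semidirect_hom mu gmul sigma sigi omega ->
  aut_continuous mu sigi J ->
  L0_continuous mu omega ->
  H1sharp_zero mu sigi J omega q ->
  H1sharp_zero mu sigi J omega p.
Proof.
move=> p1 pq _ _ _ sigmaP JP omegaP _ _ _.
exact: (H1sharp_zero_descent sigmaP JP omegaP (lt_le_trans ltr01 p1) pq).
Qed.
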